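(* Let $b\ge 2$ be an integer, let $\xi\neq 1$ be a complex number with $\xi^b=1$, let $r\ge 1$ and let $N_1,\dots,N_r$ be positive integers. Then for an arbitrary function $f:\mathbb{C}\to\mathbb{C}$ and all $x,y_1,\dots,y_r\in\mathbb{C}$, $$\sum_{n_{1}=0}^{b^{N_{1}}-1}\cdots\sum_{n_{r}=0}^{b^{N_{r}}-1}\xi^{\sum_{j=1}^{r}s_{b}(n_{j})}f\Big(x+\sum_{j=1}^{r}n_{j}y_{j}\Big)=(-1)^{\sum_{j=1}^{r}N_{j}}\sum_{k_{1}=0}^{b^{N_{1}}-N_{1}-1}\cdots\sum_{k_{r}=0}^{b^{N_{r}}-N_{r}-1}\left(\prod_{j=1}^{r}\beta_{k_{j}}^{(N_{j}-1)}\Delta_{k_{j}}^{N_{j}}\right)f\Big(x+\sum_{j=1}^{r}k_{j}y_{j}\Big).$$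
   Context: For a nonnegative integer $n$, $s_b(n)$ denotes the sum of the digits of $n$ in base $b$. For an integer $M\ge 0$, the complex weights $\beta_k^{(M)}$ (depending on $b$ and $\xi$), $0\le k\le b^{M+1}-M-2$, are defined by the generating polynomial $$\sum_{k=0}^{b^{M+1}-M-2}\beta_{k}^{(M)}z^{k}=\prod_{l=0}^{M}\frac{1-z^{b^l}}{1-z}\left(\sum_{m=0}^{b-1}\Big(\sum_{j=0}^{m}\xi^{j}\Big)z^{m b^{l}}\right).$$ The operator $\Delta_{k_j}$ is the forward difference operator in the variable $k_j$: it sends an expression $g(k_1,\dots,k_r)$ to $g(k_1,\dots,k_j+1,\dots,k_r)-g(k_1,\dots,k_j,\dots,k_r)$; $\Delta_{k_j}^{N_j}$ is its $N_j$-fold iterate. In the right-hand side the difference operators act only on $f(x+\sum_j k_jy_j)$, and the result is multiplied by $\prod_{j}\beta_{k_j}^{(N_j-1)}$. *)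

(* Defs.v *)
From mathcomp Require Import all_boot all_order all_algebra.
From mathcomp Require Import complex.
From mathcomp Require Import reals.

Set Implicit Arguments.
Unset Strict Implicit.
Unset Printing Implicit Defensive.

Import GRing.Theory.
Local Open Scope ring_scope.

(* For [1 < b] we have [n < b ^ n], so the [n] lowest base-[b] digits of [n]
   are all its digits. *)
Definition digit_sum (b n : nat) : nat :=
  (\sum_(i < n) (n %/ b ^ i) %% b)%N.

(* The division of [1 - 'X^(b ^ l)] by [1 - 'X] is exact. *)
Definition beta_poly (F : fieldType) (b : nat) (xi : F) (M : nat) : {poly F} :=
  \prod_(0 <= l < M.+1)
    ((1 - 'X^(b ^ l)) %/ (1 - 'X) *
     \sum_(0 <= m < b) (\sum_(0 <= j < m.+1) xi ^+ j) *: 'X^(m * b ^ l)).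

(* When [xi != 1] and [xi ^+ b = 1] the inner sum vanishes for [m = b - 1], so
   [beta_poly b xi M] has degree at most [b ^ M.+1 - M - 2], and it is the sum
   of the [beta b xi M k *: 'X^k] for [0 <= k <= b ^ M.+1 - M - 2]. *)
Definition beta (F : fieldType) (b : nat) (xi : F) (M k : nat) : F :=
  (beta_poly b xi M)`_k.

(* An expression in the integer variables [k_1, ..., k_r] is a function of the
   tuple [k : 'I_r -> nat]; [fdiff j] is the forward difference in [k_j]. *)
Definition fdiff (V : zmodType) (r : nat) (j : 'I_r)
    (g : ('I_r -> nat) -> V) : ('I_r -> nat) -> V :=
  fun k => g (fun i => (k i + (i == j))%N) - g k.

(* The composite of the [N j]-fold iterates of the [fdiff j]; these operators
   commute, so the order of composition is irrelevant. *)
Definition fdiff_prod (V : zmodType) (r : nat) (N : 'I_r -> nat)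
    (g : ('I_r -> nat) -> V) : ('I_r -> nat) -> V :=
  (\big[comp/id]_(j < r) iter (N j) (fdiff j)) g.

(* Main.v *)
From HB Require Import structures.
Require Import Defs.
From mathcomp Require Import all_boot all_order all_algebra.
From mathcomp Require Import complex.
From mathcomp Require Import boolp reals.
From mathcomp Require Import mpoly ring.

Set Implicit Arguments.
Unset Strict Implicit.
Unset Printing Implicit Defensive.

Import GRing.Theory.
Local Open Scope ring_scope.

(** The identity is an identity between polynomials, read through a linear
    functional. Let [g k = f (x + \sum_j k_j y_j)] for [k] in N^r, and let
    [umbral g] be the linear functional on F['X_1, ..., 'X_r] that sends the
    monomial ['X^k] to [g k]. Multiplying a monomial by ['X_j] shifts [k_j] by
    one, so multiplying the argument of [umbral g] by ['X_j - 1] amounts to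
    replacing [g] by its forward difference in [k_j] ([umbral_mulXB1], and
    [umbral_fdiff_prod] for the iterates).

    A multiple sum whose weights are a product of coefficients of univariate
    polynomials [p_j] is the value of [umbral g] at the product of the
    [p_j('X_j)] ([umbral_prod]). The left-hand side has this shape with
    [p_j = digit_poly b xi N_j], the generating polynomial of the
    [xi ^+ digit_sum b n] for [n < b ^ N_j], and the sum on the right has it
    with [p_j = beta_poly b xi (N_j).-1] and with the differences of [g] in the
    place of [g]. It remains to compare the polynomials, one variable at a time
    ([digit_poly_factor]):
      [digit_poly b xi N = (-1)^N ('X - 1)^N beta_poly b xi N.-1].

    For this, digit expansions turn the generating polynomial into the product
    over [l < N] of the sums [\sum_(m < b) xi^m 'X^(m b^l)]
    ([sum_digit_sum_prod]). As [\sum_(j < b) xi^j = 0], Abel summation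
    ([mul1B_sum_geom]) extracts from the factor of index [l] the polynomial
    [1 - 'X^(b^l)], which is [1 - 'X] times a polynomial. The cofactors so
    obtained are those that define [beta_poly]. *)

(** * Digit sums *)

(** The value of [digit_sum b n] does not depend on the number of digits that
    are summed, as long as it is at least [n]; this lets the digit sums of two
    different numbers be compared over the same positions. *)
Lemma digit_sum_widen (b n K : nat) :
  (1 < b)%N -> (n <= K)%N ->
  digit_sum b n = (\sum_(0 <= i < K) (n %/ b ^ i) %% b)%N.
Proof.
move=> hb leK; rewrite (big_cat_nat (leq0n n) leK) /= big_mkord.
rewrite [X in (_ + X)%N]big1_seq ?addn0 // => i.
rewrite mem_index_iota => /andP[_ /andP[lni _]].
by rewrite divn_small ?mod0n //; apply: leq_ltn_trans lni (ltn_expl i hb).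
Qed.

Lemma digit_sum_cons (b q d : nat) :
  (1 < b)%N -> (d < b)%N -> digit_sum b (q * b + d) = (d + digit_sum b q)%N.
Proof.
move=> hb ltd; have b0 : (0 < b)%N by apply: ltnW.
set K := (q * b + d)%N.
have leqK : (q <= K)%N by rewrite (leq_trans _ (leq_addr _ _)) ?leq_pmulr.
rewrite (digit_sum_widen hb (leqnSn K)) (digit_sum_widen hb leqK).
rewrite big_nat_recl //= expn0 divn1 modnMDl modn_small //; congr (_ + _)%N.
apply: eq_bigr => i _.
by rewrite expnS divnMA divnMDl // (divn_small ltd) addn0.
Qed.

(** Induction on [N], splitting off the lowest digit: [n = q * b + m] gives the
    factor [xi ^+ m * z ^+ m] and leaves the same sum over [q], with [z ^+ b] in
    the place of [z]. Hence the induction is over all [z]. *)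
Lemma sum_digit_sum_prod (A : comNzRingType) (b : nat) (xi z : A) (N : nat) :
  (1 < b)%N ->
  \sum_(0 <= n < b ^ N) xi ^+ digit_sum b n * z ^+ n =
  \prod_(0 <= l < N) \sum_(0 <= m < b) xi ^+ m * z ^+ (m * b ^ l).
Proof.
move=> hb; elim: N z => [|N IH] z.
  by rewrite big_nat1 big_geq // /digit_sum big_ord0 mulr1.
rewrite expnSr big_nat_mul big_nat_recl //=.
(* Positions [l.+1] in base [b] with [z] are positions [l] with [z ^+ b]. *)
under [X in _ = _ * X]eq_bigr => l _ do
  under eq_bigr => m _ do rewrite expnS mulnCA exprM.
rewrite -IH big_distrr /=; apply: eq_bigr => q _.
rewrite big_distrl /= -{1}[(q * b)%N]add0n big_addn mulSn addnK.
rewrite !big_mkord; apply: eq_bigr => m _.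
rewrite addnC digit_sum_cons // expn0 muln1 !exprD mulnC exprM; ring.
Qed.

(** * Factorization of the generating polynomial *)

(** Abel summation, with the boundary term that vanishes for [n = b] when [xi]
    is a [b]-th root of unity other than 1. *)
Lemma mul1B_sum_geom (A : comNzRingType) (xi w : A) (n : nat) :
  (1 - w) * (\sum_(0 <= m < n) (\sum_(0 <= j < m.+1) xi ^+ j) * w ^+ m) =
  \sum_(0 <= m < n) xi ^+ m * w ^+ m - (\sum_(0 <= j < n) xi ^+ j) * w ^+ n.
Proof.
elim: n => [|n IH]; first by rewrite !big_geq // mulr0 mul0r subr0.
rewrite [in LHS]big_nat_recr //= mulrDr IH [in RHS]big_nat_recr //=.
rewrite big_nat_recr //= exprS; ring.
Qed.

Lemma sum_unity_root (F : fieldType) (b : nat) (xi : F) :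
  xi != 1 -> xi ^+ b = 1 -> \sum_(0 <= j < b) xi ^+ j = 0.
Proof.
move=> xi1 xib; have /esym/eqP := subrX1 xi b.
by rewrite xib subrr mulf_eq0 subr_eq0 (negPf xi1) big_mkord => /eqP.
Qed.

Definition digit_poly (F : nzRingType) (b : nat) (xi : F) (N : nat) : {poly F} :=
  \poly_(n < b ^ N) xi ^+ digit_sum b n.

(** Each of the [N] factors of the generating polynomial contributes one factor
    [1 - 'X]; the sign comes from writing it as [- ('X - 1)], the form that
    corresponds to a forward difference. *)
Lemma digit_poly_factor (F : fieldType) (b : nat) (xi : F) (N : nat) :
  (1 < b)%N -> xi != 1 -> xi ^+ b = 1 -> (0 < N)%N ->
  digit_poly b xi N = (-1) ^+ N *: (('X - 1) ^+ N * beta_poly b xi N.-1).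
Proof.
move=> hb xi1 xib; case: N => // N _.
rewrite -mul_polyC rmorphXn rmorphN1 mulrA -exprMn mulN1r opprB.
(* The divisions in [beta_poly] are exact. *)
have X1 l : (1 - 'X : {poly F}) %| 1 - 'X^(b ^ l).
  by rewrite -[X in _ %| X - _](expr1n _ (b ^ l)) subrXX dvdp_mulr.
transitivity (\sum_(0 <= n < b ^ N.+1)
    (xi%:P) ^+ digit_sum b n * ('X : {poly F}) ^+ n).
  rewrite /digit_poly poly_def big_mkord; apply: eq_bigr => n _.
  by rewrite -polyC_exp mul_polyC.
rewrite sum_digit_sum_prod // -[X in _ ^+ X](subn0 N.+1) -prodr_const_nat.
rewrite -big_split /=; apply: eq_bigr => l _.
rewrite mulrA [_ * (_ %/ _)]mulrC divpK //.
under eq_bigr do rewrite mulnC exprM.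
rewrite (_ : \sum_(0 <= m < b) _ *: _ = \sum_(0 <= m < b)
   (\sum_(0 <= j < m.+1) (xi%:P) ^+ j) * ('X^(b ^ l)) ^+ m); last first.
  apply: eq_bigr => m _; rewrite -mul_polyC rmorph_sum /= mulnC exprM.
  by congr (_ * _); apply: eq_bigr => j _; rewrite polyC_exp.
rewrite mul1B_sum_geom; have -> : \sum_(0 <= j < b) xi%:P ^+ j = 0 :> {poly F}.
  under eq_bigr do rewrite -polyC_exp.
  by rewrite -rmorph_sum /= sum_unity_root.
by rewrite mul0r subr0.
Qed.

(** The degree bound is read off the factorization, since [digit_poly b xi N] has
    degree less than [b ^ N] and [('X - 1) ^+ N] is monic of degree [N]. It says
    that the sums over [k < b ^ N - N] meet all the coefficients. *)
Lemma size_beta_poly (F : fieldType) (b : nat) (xi : F) (N : nat) :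
  (1 < b)%N -> xi != 1 -> xi ^+ b = 1 -> (0 < N)%N ->
  (size (beta_poly b xi N.-1) <= b ^ N - N)%N.
Proof.
move=> hb xi1 xib N0; have := size_poly (b ^ N) (fun n => xi ^+ digit_sum b n).
rewrite -/(digit_poly b xi N) digit_poly_factor //.
have [-> | nz] := eqVneq (beta_poly b xi N.-1) 0; first by rewrite size_poly0.
rewrite -mul_polyC rmorphXn rmorphN1 size_Msign -polyC1.
rewrite size_monicM ?monic_exp ?monicXsubC // size_exp_XsubC addSn /=.
by rewrite leq_subRL // ltnW // (ltn_expl N hb).
Qed.

(** * Umbral evaluation of multivariate polynomials *)

(** Distributivity when the summation range depends on the factor: every range
    is embedded in the disjoint union of all of them, which reduces the claim to
    a product of sums over one common index type. *)
Lemma big_distr_dffun (A : comNzRingType) (I : finType) (T : I -> finType)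
    (P : forall i, T i -> A) :
  \prod_i \sum_(t : T i) P i t =
  \sum_(t : {dffun forall i, T i}) \prod_i P i (t i).
Proof.
set Q := fun i => [ffun t => P i t].
transitivity (\prod_i \sum_(t : T i) Q i t).
  by apply: eq_bigr => i _; apply: eq_bigr => t _; rewrite ffunE.
rewrite (reindex (@dffun_of_fprod _ T)) /=; last exact/onW_bij/dffun_of_fprod_bij.
under [LHS]eq_bigr => i _ do rewrite (big_tag (fun i => Q i : _ -> A)).
rewrite bigA_distr_big_dep -[LHS](big_fprod _ _ Q).
by apply: eq_bigr => t _; apply: eq_bigr => i _; rewrite !ffunE.
Qed.

Section Umbral.
Variables (F : comNzRingType) (r : nat).
Implicit Types (g : ('I_r -> nat) -> F) (p q : {mpoly F[r]}).

(** The linear functional that evaluates ['X_[m]] to [g m]. *)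
Definition umbral g p : F := \sum_(m <- msupp p) p@_m * g m.

(** Enlarging the support makes it possible to compare several polynomials over
    one list of monomials, as linearity requires. *)
Lemma umbralE g p (s : seq 'X_{1..r}) :
  uniq s -> {subset msupp p <= s} -> umbral g p = \sum_(m <- s) p@_m * g m.
Proof.
move=> us sub; rewrite [RHS](bigID [pred m | m \in msupp p]) /= addrC big1.
  rewrite add0r -big_filter; apply: perm_big; apply: uniq_perm.
  - exact: msupp_uniq.
  - exact: filter_uniq.
  - move=> m; rewrite mem_filter andb_idr //; exact: sub.
by move=> m /memN_msupp_eq0 ->; rewrite mul0r.
Qed.

Fact umbral_is_linear g : linear_for *%R (umbral g).
Proof.
move=> a p q; set s := undup (msupp p ++ msupp q).
have us : uniq s by apply: undup_uniq.
rewrite !(@umbralE g _ s) // ?mulr_sumr -?big_split /=.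
- apply: eq_bigr => m _; rewrite mcoeffD mcoeffZ; ring.
- by move=> m mq; rewrite mem_undup mem_cat mq orbT.
- by move=> m mp; rewrite mem_undup mem_cat mp.
move=> m /msuppD_le; rewrite mem_undup !mem_cat.
by case/orP => [/msuppZ_le -> //| ->]; rewrite orbT.
Qed.

HB.instance Definition _ g :=
  GRing.isLinear.Build F {mpoly F[r]} F *%R (umbral g) (umbral_is_linear g).

Lemma umbralX g m : umbral g 'X_[m] = g m.
Proof. by rewrite /umbral msuppX big_seq1 mcoeffX eqxx mul1r. Qed.

(** By linearity it is enough to see it on a monomial ['X_[m]], where the left
    side is [g (m + U_(j)) - g m]. *)
Lemma umbral_mulXB1 g j q : umbral g (('X_j - 1) * q) = umbral (fdiff j g) q.
Proof.
rewrite [q]mpolyE mulr_sumr !linear_sum /=; apply: eq_bigr => m _.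
rewrite -scalerAr !linearZ /= mulrBl mul1r linearB /= -mpolyXD !umbralX.
congr (_ * (g _ - _)); apply/funext => i.
by rewrite mnmDE mnm1E addnC eq_sym.
Qed.

Lemma umbral_fdiff_prod g (N : 'I_r -> nat) q :
  umbral g (\prod_(j < r) ('X_j - 1) ^+ N j * q) = umbral (fdiff_prod N g) q.
Proof.
(* The outermost operator of the composite belongs to the head of the list, so
   its factor of the product is the last one to be absorbed. *)
rewrite /fdiff_prod; elim: (index_enum _) q => [|j s IH] q.
  by rewrite !big_nil mul1r.
rewrite !big_cons mulrAC mulrC IH /=.
elim: (N j) q => [|n IHn] q; first by rewrite mul1r.
by rewrite exprSr -mulrA IHn umbral_mulXB1.
Qed.

(** The bounds [d j] may exceed the sizes of the [p j], because the extra
    coefficients are zero. *)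
Lemma umbral_prod g (d : 'I_r -> nat) (p : 'I_r -> {poly F}) :
  (forall j, (size (p j) <= d j)%N) ->
  umbral g (\prod_(j < r) horner_alg 'X_j (p j)) =
  \sum_(n : {dffun forall j, 'I_(d j)})
     (\prod_(j < r) (p j)`_(n j)) * g (fun j => n j : nat).
Proof.
move=> size_p.
have expand j : horner_alg ('X_j : {mpoly F[r]}) (p j) =
    \sum_(i < d j) (p j)`_i *: 'X_j ^+ i.
  have def_p : p j = \sum_(i < d j) (p j)`_i *: 'X^i.
    rewrite -poly_def; apply/polyP => i; rewrite coef_poly.
    by case: ltnP => // /(leq_trans (size_p j)) /leq_sizeP ->.
  rewrite [in LHS]def_p linear_sum /=.
  by apply: eq_bigr => i _; rewrite linearZ /= rmorphXn /= horner_algX mulr_algl.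
under eq_bigr do rewrite expand.
rewrite big_distr_dffun linear_sum /=; apply: eq_bigr => n _.
rewrite scaler_prod linearZ /=; congr (_ * _).
pose m := [multinom (n j : nat) | j < r].
rewrite (_ : (fun j => n j : nat) = m); last by apply/funext => j; rewrite mnmE.
rewrite -umbralX mpolyXE_id; congr umbral.
by apply: eq_bigr => j _; rewrite mnmE.
Qed.

End Umbral.

Theorem theorem11 (R : realType) (b : nat) (hb : (2 <= b)%N)
    (xi : R[i]) (hxi1 : xi != 1) (hxib : xi ^+ b = 1)
    (r : nat) (hr : (1 <= r)%N) (N : 'I_r -> nat)
    (hN : forall j, (0 < N j)%N)
    (f : R[i] -> R[i]) (x : R[i]) (y : 'I_r -> R[i]) :
  \sum_(n : {dffun forall j : 'I_r, 'I_(b ^ N j)})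
     xi ^+ (\sum_(j < r) digit_sum b (n j))%N
       * f (x + \sum_(j < r) (n j)%:R * y j)
  = (-1) ^+ (\sum_(j < r) N j)%N *
    \sum_(k : {dffun forall j : 'I_r, 'I_(b ^ N j - N j)})
       (\prod_(j < r) beta b xi (N j).-1 (k j)) *
       fdiff_prod N (fun k' : 'I_r -> nat => f (x + \sum_(j < r) (k' j)%:R * y j))
         (fun j => k j : nat).
Proof.
set g := fun k : 'I_r -> nat => f (x + \sum_(j < r) (k j)%:R * y j).
have -> : \sum_(n : {dffun forall j : 'I_r, 'I_(b ^ N j)})
     xi ^+ (\sum_(j < r) digit_sum b (n j))%N
       * f (x + \sum_(j < r) (n j)%:R * y j)
  = umbral g (\prod_(j < r) horner_alg 'X_j (digit_poly b xi (N j))).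
  rewrite (@umbral_prod _ _ g (fun j => b ^ N j)%N) => [|j]; last exact: size_poly.
  apply: eq_bigr => n _; congr (_ * _); rewrite -prodrXr.
  by apply: eq_bigr => j _; rewrite coef_poly ltn_ord.
rewrite -(@umbral_prod _ _ _ (fun j => b ^ N j - N j)%N
    (fun j => beta_poly b xi (N j).-1)) => [|j]; last exact: size_beta_poly.
(* Both sides are now values of [umbral g]; the arguments agree factorwise. *)
rewrite -umbral_fdiff_prod -big_split -prodrXr -linearZ /= -scaler_prod.
congr umbral; apply: eq_bigr => j _.
rewrite digit_poly_factor // linearZ rmorphM rmorphXn rmorphB /= horner_algX.
by rewrite rmorph1 mulr_algl.
Qed.
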